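(* Let $\mathbf{5}$ be the set of all formulas of the form $\neg\mathrm{K}\varphi\rightarrow\mathrm{K}\neg\mathrm{K}\varphi$. No theory containing $\mathbf{5}$ as a subset is closed generic.
   Context: Fix a nonempty set of symbols called propositional atoms and a symbol $\mathrm{K}$ which is not a propositional atom. Formulas are defined recursively: every propositional atom is a formula; if $\varphi,\psi$ are formulas then so are $\neg\varphi$, $(\varphi\wedge\psi)$, $(\varphi\vee\psi)$, $(\varphi\rightarrow\psi)$; if $\varphi$ is a formula then so is $\mathrm{K}(\varphi)$. A formula is basic if it is a propositional atom or of the form $\mathrm{K}\varphi$. A theory is a set of formulas. A model is a function assigning a truth value to every basic formula; truth $\mathscr M\models\varphi$ of an arbitrary formula is defined from the values of basic formulas by the classical truth tables (formulas $\mathrm{K}\varphi$ are treated like atoms). $\mathscr M\models T$ means $\mathscr M\models\varphi$ for all $\varphi\in T$; $T\models\varphi$ means every model of $T$ satisfies $\varphi$. A theory $T$ is closed if $\varphi\in T$ implies $\mathrm{K}\varphi\in T$. For a theory $T$ and a set $S$ of propositional atoms, $\mathscr M_{T,S}$ is the model with $\mathscr M_{T,S}\models p$ iff $p\in S$ for atoms $p$, and $\mathscr M_{T,S}\models\mathrm{K}\varphi$ iff $T\models\varphi$. A theory $T$ is closed generic if for every set $S$ of propositional atoms and every closed theory $T'\supseteq T$, $\mathscr M_{T',S}\models T$. *)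

(* Defs.v *)
From mathcomp Require Import all_boot boolp classical_sets.
Set Implicit Arguments. Unset Strict Implicit. Unset Printing Implicit Defensive.
Local Open Scope classical_set_scope.

Inductive formula (A : Type) : Type :=
| Atom of A
| Neg of formula A
| And of formula A & formula A
| Or of formula A & formula A
| Imp of formula A & formula A
| Know of formula A.

Definition is_basic (A : Type) (f : formula A) : bool :=
  match f with Atom _ | Know _ => true | _ => false end.

Definition theory (A : Type) : Type := set (formula A).

Definition model (A : Type) : Type := {f : formula A | is_basic f} -> bool.

Definition basic_atom (A : Type) (p : A) : {f : formula A | is_basic f} :=
  exist _ (Atom p) isT.

Definition basic_know (A : Type) (f : formula A) : {f : formula A | is_basic f} :=
  exist _ (Know f) isT.

Fixpoint sat (A : Type) (M : model A) (f : formula A) : bool :=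
  match f with
  | Atom p => M (basic_atom p)
  | Neg g => ~~ sat M g
  | And g h => sat M g && sat M h
  | Or g h => sat M g || sat M h
  | Imp g h => sat M g ==> sat M h
  | Know g => M (basic_know g)
  end.

Definition models_theory (A : Type) (M : model A) (T : theory A) : Prop :=
  forall f, T f -> sat M f.

Definition entails (A : Type) (T : theory A) (f : formula A) : Prop :=
  forall M : model A, models_theory M T -> sat M f.

Definition closed_theory (A : Type) (T : theory A) : Prop :=
  forall f, T f -> T (Know f).

(* The last branch is never reached, since the argument is a basic formula. *)
Definition canonical_model (A : Type) (T : theory A) (S : set A) : model A :=
  fun b => match sval b with
           | Atom p => `[< S p >]
           | Know f => `[< entails T f >]
           | _ => false
           end.

Definition closed_generic (A : Type) (T : theory A) : Prop :=
  forall (S : set A) (T' : theory A),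
    closed_theory T' -> T `<=` T' -> models_theory (canonical_model T' S) T.

Definition schema5 (A : Type) : theory A :=
  [set f | exists g : formula A, f = Imp (Neg (Know g)) (Know (Neg (Know g)))].
Arguments schema5 : clear implicits.

(* Main.v *)
(** Let [T'] be the closure of [T] under [K] and let [T''] be that of [T] plus an
    atom [p]. Genericity makes each of them true in its own canonical models.
    Reading [T'] with [p] false, [T'] does not entail [p], so axiom 5 in that
    model says that [T'] entails [~ K p]; but [T''] extends [T'], and its
    canonical model with [p] true satisfies [K p]. *)
Require Import Defs.
From mathcomp Require Import all_boot boolp classical_sets.
Local Open Scope classical_set_scope.

Inductive know_closure (A : Type) (X : theory A) : theory A :=
| know_closure_base f : X f -> know_closure A X f
| know_closure_know f : know_closure A X f -> know_closure A X (Know f).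

Lemma know_closure_mono (A : Type) (X Y : theory A) :
  X `<=` Y -> know_closure A X `<=` know_closure A Y.
Proof.
move=> XY f; elim=> {}f; first by move=> /XY; exact: know_closure_base.
by move=> _; exact: know_closure_know.
Qed.

Lemma entails_in (A : Type) (X : theory A) (f : formula A) : X f -> entails X f.
Proof. by move=> Xf M; apply. Qed.

(** Beyond [X], the closure contains only formulas [Know f] with [f] already in it; such an [f] is
    entailed, which is what makes [Know f] true in the canonical model. *)
Lemma canonical_model_know_closure (A : Type) (X : theory A) (S : set A) :
  models_theory (canonical_model (know_closure A X) S) X ->
  models_theory (canonical_model (know_closure A X) S) (know_closure A X).
Proof.
move=> MX f [{}f /MX //|{}f Xf].
by apply/asboolP; exact: entails_in.
Qed.

Theorem theorem28 (A : Type) (hA : inhabited A) (T : theory A)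
  (hT : schema5 A `<=` T) : ~ closed_generic T.
Proof.
move=> genT; case: hA => p.
have sat_closure X S : T `<=` X ->
    models_theory (canonical_model (know_closure A X) S) T.
  move=> TX; apply: genT => [f|f /TX]; first exact: know_closure_know.
  exact: know_closure_base.
have nentails_p : ~ entails (know_closure A T) (Atom p).
  (* With [set0] every atom is false, so this model of the closure refutes [p]. *)
  move=> Tp; have MT := canonical_model_know_closure A T set0
    (sat_closure T set0 (fun _ => id)).
  by have /asboolP := Tp _ MT.
have entails_nKp : entails (know_closure A T) (Neg (Know (Atom p))).
  have T5 : T (Imp (Neg (Know (Atom p))) (Know (Neg (Know (Atom p))))).
    by apply: hT; exists (Atom p).
  have /implyP := sat_closure T set0 (fun _ => id) _ T5.
  by move=> H; apply/asboolP/H/negP => /asboolP.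
pose X : theory A := T `|` [set Atom p].
have TX : T `<=` X by move=> f; left.
have Xp : know_closure A X (Atom p) by apply: know_closure_base; right.
have MX : models_theory (canonical_model (know_closure A X) setT)
    (know_closure A X).
  (* Genericity covers [T]; the added [p] holds because [setT] makes every atom true. *)
  apply: canonical_model_know_closure => f [Tf|->]; last exact/asboolP.
  exact: sat_closure.
have /negP := entails_nKp _ (fun f Tf => MX f (know_closure_mono A T X TX f Tf)).
by apply; exact: MX (know_closure_know _ _ _ Xp).
Qed.
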